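(* Let $n, p, s$ be non-negative integers with $1 \le 2p+s \le n$. Let $M_n$ be the graph with vertex set $V(M_n)=\{a_1,\dots,a_n,b_1,\dots,b_n\}$ and edge set $\{a_1b_1, a_2b_2,\dots,a_nb_n\}$. Let $\mathcal{H}^{(p,s)}(n)$ be the family of all subsets $H\subseteq V(M_n)$ with $|H|=2p+s$ such that $H$ spans exactly $p$ edges of $M_n$ (equivalently, $H$ consists of the two endpoints of each of $p$ edges together with $s$ further vertices, no two of which are endpoints of the same edge). Then $\mathcal{H}^{(p,s)}(n)$ has the Erd\H{o}s--Ko--Rado property: there exists a vertex $x\in V(M_n)$ such that every intersecting subfamily $\mathcal{F}\subseteq \mathcal{H}^{(p,s)}(n)$ satisfies $|\mathcal{F}|\le |\{H\in\mathcal{H}^{(p,s)}(n) : x\in H\}|$.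
   Context: A family of sets is intersecting if any two of its members have nonempty intersection. *)

(* Defs.v *)
From mathcomp Require Import all_boot.

Set Implicit Arguments.
Unset Strict Implicit.
Unset Printing Implicit Defensive.

Definition intersecting (T : finType) (F : {set {set T}}) : Prop :=
  forall A B : {set T}, A \in F -> B \in F -> A :&: B != set0.

Definition has_EKR (T : finType) (H : {set {set T}}) : Prop :=
  exists x : T, forall F : {set {set T}},
    F \subset H -> intersecting F -> #|F| <= #|[set A in H | x \in A]|.

(* The vertices of M_n: a_i is [inl i] and b_i is [inr i]. *)
Definition vertex (n : nat) : finType := ('I_n + 'I_n)%type.

Definition edges (n : nat) : {set {set vertex n}} :=
  [set [set (inl i : vertex n); (inr i : vertex n)] | i : 'I_n].

Definition spanned_edges (n : nat) (A : {set vertex n}) : {set {set vertex n}} :=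
  [set e in edges n | e \subset A].

Definition Hps (n p s : nat) : {set {set vertex n}} :=
  [set A : {set vertex n} | (#|A| == 2 * p + s) && (#|spanned_edges A| == p)].

(* Main.v *)
(* Katona's cycle method. On the cycle Z_{2n} put a_i at 2i and b_i at 2i + s.
   Then a window [t, t + 2p + s) contains both ends of edge i exactly when 2i
   lies in [t, t + 2p), which happens for p values of i, and it contains 2p + s
   vertices in all: if s is odd every position carries one vertex; if s is even
   the even positions carry two each, the odd ones none, and the window length
   is even. So the 2n windows belong to H^(p,s)(n), every vertex lies in 2p + s
   of them, and, as 2(2p + s) <= 2n, an intersecting family contains at most
   2p + s of them, no more than a star does. Averaging over the symmetries
   of M_n, which act transitively on H^(p,s)(n), gives the bound with equality
   for stars. *)
Require Import Defs.
From mathcomp Require Import all_boot.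
From mathcomp Require Import fingroup perm zify.

Set Implicit Arguments.
Unset Strict Implicit.
Unset Printing Implicit Defensive.

(** * Averaging over symmetries *)

(** Count pairs ([g], [t]) with [g @: W t] in a family. Each [g] gives at most [h] of them for an
    intersecting family and exactly [h] for a star, while all members of [H] are hit equally
    often. *)
Lemma katona_EKR {T : finType} (H : {set {set T}}) (N h : nat)
    (W : 'I_N -> {set T}) (x : T) :
  0 < h ->
  (forall t, W t \in H) ->
  (forall B C, B \in H -> C \in H ->
     exists2 g : {perm T},
       {in H, forall D : {set T}, g @: D \in H} & g @: B = C) ->
  (forall y, #|[set t | y \in W t]| = h) ->
  (forall I : {set 'I_N},
     {in I &, forall t u, W t :&: W u != set0} -> #|I| <= h) ->
  has_EKR H.
Proof.
move=> h0 WH trH Wdeg Wint; exists x => F FH Fint.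
pose G := [set g : {perm T} | [forall D in H, g @: D \in H]].
(* [w] is constant on [H]: composing with [v] sends the pairs counted by [w B]
   to pairs counted by [w (v @: B)]. *)
pose w B := \sum_(g in G) #|[set t | g @: W t == B]|.
have GP (g : {perm T}) :
    reflect {in H, forall D : {set T}, g @: D \in H} (g \in G).
  by rewrite inE; apply: forall_inP.
have w_le B C : B \in H -> C \in H -> w B <= w C.
  move=> BH CH; have [v vH vB] := trH B C BH CH.
  have vG : [set (g * v)%g | g in G] \subset G.
    apply/subsetP => _ /imsetP [g /GP gH ->]; apply/GP => D DH.
    have -> : (g * v)%g @: D = v @: (g @: D).
      by rewrite -imset_comp; apply: eq_imset => y; rewrite permM.
    by apply/vH/gH.
  rewrite /w [X in _ <= X](big_setID [set (g * v)%g | g in G]) /=.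
  rewrite (setIidPr vG) big_imset /=; last by move=> a b _ _ /mulIg.
  apply: leq_trans (leq_addr _ _); apply: leq_sum => g _.
  apply: subset_leq_card; apply/subsetP => t; rewrite !inE => /eqP gW.
  apply/eqP; rewrite -vB -gW -imset_comp.
  by apply: eq_imset => y; rewrite permM.
have w_eq B C : B \in H -> C \in H -> w B = w C.
  by move=> BH CH; apply/eqP; rewrite eqn_leq !w_le.
have sum_w (E : {set {set T}}) :
    \sum_(B in E) w B = \sum_(g in G) #|[set t | g @: W t \in E]|.
  rewrite exchange_big /=; apply: eq_bigr => g _.
  rewrite -[RHS]sum1dep_card.
  rewrite (partition_big (fun t => g @: W t) (mem E)) //=.
  apply: eq_bigr => B BE; rewrite -sum1dep_card; apply: eq_bigl => t.
  by case: eqP => [->|]; rewrite ?BE ?andbF.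
have F_le : \sum_(B in F) w B <= #|G| * h.
  rewrite sum_w -sum_nat_const; apply: leq_sum => g _.
  apply: Wint => t u; rewrite !inE => tF uF.
  have := Fint _ _ tF uF; rewrite -imsetI; last by move=> a b _ _ /perm_inj.
  by rewrite imset_eq0.
set S := [set A in H | x \in A].
have S_eq : \sum_(B in S) w B = #|G| * h.
  rewrite sum_w -sum_nat_const; apply: eq_bigr => g /GP gH.
  (* [x] lies in [g @: W t] exactly when its preimage under [g] lies in [W t]. *)
  rewrite -(Wdeg ((g^-1)%g x)); congr #|pred_of_set _|; apply/setP => t.
  rewrite !inE gH ?WH //=.
  by rewrite -{1}(permKV g x) mem_imset //; apply: perm_inj.
have G0 : 0 < #|G|.
  apply/card_gt0P; exists 1%g; apply/GP => D DH.
  have -> : (1%g : {perm T}) @: D = D.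
    by rewrite -[RHS]imset_id; apply: eq_imset => y; rewrite perm1.
  by [].
have [->|[B BF]] := set_0Vmem F; first by rewrite cards0.
have BH := subsetP FH _ BF.
have wF : \sum_(C in F) w C = #|F| * w B.
  rewrite -sum_nat_const; apply: eq_bigr => C CF.
  by apply: w_eq => //; apply: (subsetP FH).
have wS : \sum_(C in S) w C = #|S| * w B.
  rewrite -sum_nat_const; apply: eq_bigr => C; rewrite inE => /andP [CH _].
  exact: w_eq.
have w0 : 0 < w B.
  have : 0 < #|S| * w B by rewrite -wS S_eq muln_gt0 G0.
  by rewrite muln_gt0 => /andP [].
by rewrite -(leq_pmul2r w0) -wF -wS S_eq.
Qed.

(** * Windows on a cycle *)

(* (z - t) mod N, for t, z < N. *)
Definition offset (N z t : nat) : nat := if t <= z then z - t else z + N - t.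

Lemma offset_cases N z t :
  t <= z /\ offset N z t = z - t \/ z < t /\ offset N z t = z + N - t.
Proof. by rewrite /offset; case: leqP => _; [left | right]. Qed.

Lemma offset_lt N z t : z < N -> t < N -> offset N z t < N.
Proof. by have := offset_cases N z t; lia. Qed.

Lemma offsetK N z t : z < N -> t < N -> offset N z (offset N z t) = t.
Proof.
by have := offset_cases N z t; have := offset_cases N z (offset N z t); lia.
Qed.

(** The involution [offset N z] carries the numbers below [h] bijectively to the starts [t] being
    counted. *)
Lemma card_windows_at (N h z : nat) : z < N -> h <= N ->
  #|[set t : 'I_N | offset N z t < h]| = h.
Proof.
move=> zN hN.
have fN (i : 'I_h) : offset N z i < N.
  by apply: offset_lt => //; apply: leq_trans (ltn_ord i) hN.
pose f (i : 'I_h) := Ordinal (fN i).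
have fK (i : 'I_h) : offset N z (f i) = i.
  by rewrite /= offsetK //; apply: leq_trans (ltn_ord i) hN.
rewrite -[RHS](card_ord h) -(card_imset predT (f := f)); last first.
  by move=> i j fij; apply: val_inj; rewrite /= -[LHS]fK -[RHS]fK fij.
congr #|pred_of_set _|; apply/setP => t; rewrite inE.
apply/idP/imsetP => [th|[i _ ->]]; last by rewrite fK.
by exists (Ordinal th) => //; apply: val_inj; rewrite /= offsetK.
Qed.

Lemma card_intersecting_windows (N h : nat) (I : {set 'I_N}) :
  0 < h -> h.*2 <= N ->
  {in I &, forall t u : 'I_N,
     exists2 z, z < N & (offset N z t < h) && (offset N z u < h)} ->
  #|I| <= h.
Proof.
move=> h0 hN Iint; have [->|[u uI]] := set_0Vmem I; first by rewrite cards0.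
(* [inord] needs a codomain of successor form; from here on the window length is [h.+1]. *)
case: h h0 hN Iint => // h _ hN Iint.
pose d (t : 'I_N) := offset N t u.
pose f t : 'I_h.+1 := inord (if d t < h.+1 then d t else d t - (N - h.+1)).
have uN := ltn_ord u.
(* The windows starting at distances [j] and [j + N - h.+1] after [u] are
   disjoint, so [I] contains at most one of each such pair: [f], which
   identifies them, is injective on [I]. *)
have near t : t \in I -> d t <= h \/ N - h <= d t < N.
  move=> tI; have [z zN] := Iint t u tI uI; have := ltn_ord t.
  have := offset_cases N t u; have := offset_cases N z t.
  by have := offset_cases N z u; rewrite /d; lia.
rewrite -[leqRHS](card_ord h.+1) -(card_in_imset (f := f) (D := I)).
  exact: max_card.
move=> t t' tI t'I /(congr1 val).
have := Iint t t' tI t'I; have := near t tI; have := near t' t'I.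
move=> nt' nt [z zN zz] /=.
rewrite !inordK; try by case: ifP; lia.
move=> eqf; apply: val_inj => /=; move: eqf nt nt' zz.
have := ltn_ord t; have := ltn_ord t'.
rewrite /d.
have [[? ->]|[? ->]] := offset_cases N z t;
  have [[? ->]|[? ->]] := offset_cases N z t';
  have [[? ->]|[? ->]] := offset_cases N t u;
  have [[? ->]|[? ->]] := offset_cases N t' u;
  by do 2 case: ifP; lia.
Qed.

Lemma card_even_in_window (n m t : nat) : t < n.*2 -> m <= n.*2 ->
  #|[set i : 'I_n | offset n.*2 i.*2 t < m]| = (m + ~~ odd t)./2.
Proof.
move=> tn mn; set c := _./2.
(* Half of the [j]-th even position from [t] on, reduced modulo [n]. *)
pose f0 j := let a := uphalf t + j in if a < n then a else a - n.
have fN (j : 'I_c) : f0 j < n.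
  by have := ltn_ord j; rewrite /f0 /c; case: ifP; lia.
pose f (j : 'I_c) := Ordinal (fN j).
rewrite -[RHS](card_ord c) -(card_imset predT (f := f)); last first.
  move=> i j /(congr1 val) /=; have := ltn_ord i; have := ltn_ord j.
  move=> ci cj fij; apply: val_inj; move: ci cj fij.
  by rewrite /= /f0 /c; do 2 case: ifP; lia.
congr #|pred_of_set _|; apply/setP => i; rewrite inE.
apply/idP/imsetP => [ti|[j _ ->]].
  (* The offset is [2j] or [2j + 1] according to the parity of [t], so halving recovers [j]. *)
  have jc : (offset n.*2 i.*2 t)./2 < c.
    by have := ltn_ord i; have := offset_cases n.*2 i.*2 t; rewrite /c; lia.
  exists (Ordinal jc) => //; apply: val_inj => /=.
  move: ti; have := ltn_ord i; have := offset_cases n.*2 i.*2 t.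
  by rewrite /f0; case: ifP; lia.
have := ltn_ord j; have := offset_cases n.*2 (f0 j).*2 t; rewrite /= /c /f0.
by case: ifP; lia.
Qed.

(* A multiset in {0, 1, 2} is determined by its size, its sum and the
   multiplicity of 2. *)
Lemma count_le2 (a : pred nat) (r : seq nat) (c := count_mem 2 r) :
  all (leq^~ 2) r ->
  count a r =
    a 0 * (size r + c - sumn r) + a 1 * (sumn r - c.*2) + a 2 * c.
Proof.
rewrite {}/c => r2.
(* Truncated subtraction would block the induction: one difference is moved across, and the bounds
   carried along keep both exact. *)
suff: count a r + a 0 * sumn r =
        a 0 * (size r + count_mem 2 r) +
        a 1 * (sumn r - (count_mem 2 r).*2) + a 2 * count_mem 2 r
      /\ (count_mem 2 r).*2 <= sumn r <= size r + count_mem 2 r.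
  move=> [eq_count /andP [_ le_sum]].
  apply: (@addIn (a 0 * sumn r)); rewrite eq_count [RHS]addnAC.
  by congr (_ + _); rewrite [RHS]addnAC -mulnDr subnK.
elim: r r2 => [|[|[|[|//]]] r IH] /=; first by rewrite !muln0.
all: move=> /IH; case: (a 0); case: (a 1); case: (a 2).
all: by rewrite /= ?mul1n ?mul0n; lia.
Qed.

(** * Symmetries of the matching *)

Section Vertices.

Variable n : nat.
Implicit Types A B : {set vertex n}.

Definition edge_deg A (i : 'I_n) : nat :=
  ((inl i : vertex n) \in A) + ((inr i : vertex n) \in A).

Lemma card_vertices A :
  #|A| = #|[set i | (inl i : vertex n) \in A]| +
         #|[set i | (inr i : vertex n) \in A]|.
Proof. by rewrite -!sum1dep_card -sum1_card big_sumType. Qed.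

Lemma card_edge_deg A : #|A| = \sum_i edge_deg A i.
Proof.
rewrite card_vertices big_split /=.
congr (_ + _); rewrite -sum1dep_card big_mkcond.
all: by apply: eq_bigr => i _; case: (_ \in A).
Qed.

Lemma card_spanned_edges A :
  #|spanned_edges A| = #|[set i | edge_deg A i == 2]|.
Proof.
pose e i := [set (inl i : vertex n); (inr i : vertex n)].
have e_inj : injective e.
  move=> i j /setP /(_ (inl i)); rewrite !inE eqxx /=.
  by case/esym/orP => /eqP // [].
rewrite -(card_imset _ e_inj); congr #|pred_of_set _|; apply/setP => E.
rewrite inE; apply/andP/imsetP => [[/imsetP [i _ ->]]|[i]].
  rewrite subUset !sub1set => /andP [a b]; exists i => //.
  by rewrite inE /edge_deg a b.
rewrite inE /edge_deg => ab ->; split; first exact: imset_f.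
rewrite subUset !sub1set.
by move: ab; do 2 case: (_ \in A).
Qed.

Lemma mem_Hps p s A : (A \in Hps n p s) =
  (\sum_i edge_deg A i == 2 * p + s) && (#|[set i | edge_deg A i == 2]| == p).
Proof. by rewrite inE card_edge_deg card_spanned_edges. Qed.

(** The automorphisms of M_n, forming a hyperoctahedral group: [e] marks the edges whose ends are
    swapped. *)
Definition signed_fun (q : 'S_n) (e : 'I_n -> bool) (v : vertex n) : vertex n :=
  match v with
  | inl i => if e i then inr (q i) else inl (q i)
  | inr i => if e i then inl (q i) else inr (q i)
  end.

Lemma signed_fun_inj q e : injective (signed_fun q e).
Proof.
by move=> [i|i] [j|j] /=; case ei: (e i); case ej: (e j) => // -[/perm_inj ij];
  move: ei ej; rewrite ij => ->.
Qed.

Definition signed_perm q e : {perm vertex n} := perm (@signed_fun_inj q e).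

Lemma mem_signed_perm (q : 'S_n) (e : 'I_n -> bool) A i :
  ((inl (q i) : vertex n) \in signed_perm q e @: A)
    = ((if e i then inr i else inl i : vertex n) \in A) /\
  ((inr (q i) : vertex n) \in signed_perm q e @: A)
    = ((if e i then inl i else inr i : vertex n) \in A).
Proof.
have gv v : (signed_fun q e v \in signed_perm q e @: A) = (v \in A).
  by rewrite -(mem_imset A v (@perm_inj _ (signed_perm q e))) permE.
by split; case ei: (e i); rewrite -gv /= ei.
Qed.

Lemma edge_deg_signed_perm (q : 'S_n) e A i :
  edge_deg (signed_perm q e @: A) (q i) = edge_deg A i.
Proof.
rewrite /edge_deg; have [-> ->] := mem_signed_perm q e A i.
by case: (e i); rewrite // addnC.
Qed.

Lemma signed_perm_Hps p s (q : 'S_n) e A :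
  A \in Hps n p s -> signed_perm q e @: A \in Hps n p s.
Proof.
have sumE : \sum_i edge_deg (signed_perm q e @: A) i = \sum_i edge_deg A i.
  rewrite (reindex_inj (@perm_inj _ q)).
  by apply: eq_bigr => i _; rewrite edge_deg_signed_perm.
have cardE : #|[set i | edge_deg (signed_perm q e @: A) i == 2]| =
             #|[set i | edge_deg A i == 2]|.
  rewrite -!sum1dep_card (reindex_inj (@perm_inj _ q)).
  by apply: eq_bigl => i; rewrite edge_deg_signed_perm.
by rewrite !mem_Hps sumE cardE.
Qed.

Lemma Hps_transitive p s A B : A \in Hps n p s -> B \in Hps n p s ->
  exists2 g : {perm vertex n},
    {in Hps n p s, forall D : {set vertex n}, g @: D \in Hps n p s} &
    g @: A = B.
Proof.
rewrite !mem_Hps => /andP [/eqP sA /eqP cA] /andP [/eqP sB /eqP cB].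
pose r D := [tuple edge_deg D i | i < n].
have r2 D : all (leq^~ 2) (r D).
  by apply/allP => _ /mapP [i _ ->]; rewrite /edge_deg; do 2 case: (_ \in D).
have rsum D : sumn (r D) = \sum_i edge_deg D i.
  by rewrite sumnE big_map big_enum.
have rcount D : count_mem 2 (r D) = #|[set i | edge_deg D i == 2]|.
  rewrite count_map -size_filter cardE /enum_mem -enumT; congr size.
  by apply: eq_filter => i; rewrite !inE.
have /tuple_permP [q /val_inj qE] : perm_eq (r A) (r B).
  apply/seq.permP => a; rewrite (count_le2 a (r2 A)) (count_le2 a (r2 B)).
  by rewrite !size_tuple !rsum !rcount sA sB cA cB.
have degq i : edge_deg A i = edge_deg B (q i).
  by have := congr1 (fun u => tnth u i) qE; rewrite !tnth_mktuple.
(* Swap where the a-ends disagree; equal degrees then force the b-ends to match as well. *)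
pose e i := ((inl i : vertex n) \in A) != ((inl (q i) : vertex n) \in B).
exists (signed_perm q e); first by move=> D; apply: signed_perm_Hps.
apply/setP => v; pose i := (q^-1)%g (match v with inl j | inr j => j end).
have := mem_signed_perm q e A i; move: (degq i).
rewrite /edge_deg /e permKV /i {i}.
rewrite !(fun_if (fun v : vertex n => v \in A)).
by case: v => j deg [ml mr]; rewrite (ml, mr); move: deg; do 4 case: (_ \in _).
Qed.

End Vertices.

(** * Windows of the cyclic arrangement *)

Section Windows.

Variables n p s : nat.
Hypothesis hps : 1 <= 2 * p + s <= n.

(** Under [hps], [s <= n], so one subtraction reduces modulo [n.*2]. *)
Definition position (v : vertex n) : nat :=
  match v with
  | inl i => i.*2
  | inr i => if i.*2 + s < n.*2 then i.*2 + s else i.*2 + s - n.*2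
  end.

Definition window (t : 'I_n.*2) : {set vertex n} :=
  [set v | offset n.*2 (position v) t < 2 * p + s].

Lemma position_lt v : position v < n.*2.
Proof. by case: v => i /=; have := ltn_ord i; [|case: ifP]; lia. Qed.

Lemma window_Hps t : window t \in Hps n p s.
Proof.
have tn := ltn_ord t.
rewrite inE card_spanned_edges card_vertices; apply/andP; split; apply/eqP.
  have -> : [set i : 'I_n | (inl i : vertex n) \in window t] =
            [set i : 'I_n | offset n.*2 i.*2 t < 2 * p + s].
    by apply/setP => i; rewrite !inE.
  (* Shift the cycle by s to move the b_i onto the a_i. *)
  have -> : [set i : 'I_n | (inr i : vertex n) \in window t] =
            [set i : 'I_n | offset n.*2 i.*2 (offset n.*2 t s) < 2 * p + s].
    apply/setP => i; have := ltn_ord i; rewrite !inE /=.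
    have := offset_cases n.*2 i.*2 (offset n.*2 t s).
    have := offset_cases n.*2 t s; set z := if _ then _ else _.
    by have := offset_cases n.*2 z t; rewrite /z; case: ifP; lia.
  rewrite !card_even_in_window //; try lia; last first.
    by apply: offset_lt => //; lia.
  (* For odd [s], exactly one of the starts [t] and [t - s] is even, so one half rounds up and the
     other down; for even [s] no rounding matters. *)
  by have := offset_cases n.*2 t s; lia.
(* If a_i has offset [z < 2p + s], then b_i has offset [z + s], without wrapping because
   [2p + 2s <= 2n]; it is in the window exactly when [z < 2p]. *)
have -> : [set i : 'I_n | edge_deg (window t) i == 2] =
          [set i : 'I_n | offset n.*2 i.*2 t < 2 * p].
  apply/setP => i; rewrite !inE /edge_deg !inE /=; have := ltn_ord i.
  have := offset_cases n.*2 i.*2 t; set z := if _ then _ else _.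
  by have := offset_cases n.*2 z t; rewrite /z; case: ifP; lia.
by rewrite card_even_in_window //; lia.
Qed.

End Windows.

Theorem theorem2p1 (n p s : nat) (hps : 1 <= 2 * p + s <= n) :
  has_EKR (Hps n p s).
Proof.
have n0 : 0 < n by lia.
(* Any vertex could be the centre of the star; the first a-vertex is chosen. *)
apply: (@katona_EKR _ _ _ (2 * p + s) (@window n p s) (inl (Ordinal n0))).
- by lia.
- exact: window_Hps hps.
- exact: Hps_transitive.
- move=> y; rewrite -[RHS](@card_windows_at n.*2 _ (position s y)); try lia.
    by congr #|pred_of_set _|; apply/setP => t; rewrite !inE.
  exact: position_lt hps _.
- move=> I Iint; apply: card_intersecting_windows; try lia.
  move=> t u tI uI; have /set0Pn [v] := Iint t u tI uI.
  rewrite !inE => vtu; exists (position s v) => //; exact: position_lt hps _.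
Qed.
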